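(* The $K$-adaptability problem with constraint uncertainty $$ \begin{array}{cl} \min & \displaystyle\max_{\overline{\boldsymbol\xi}\in\Xi}\left\{\begin{array}{cl}\displaystyle\min_{k\in\mathcal K} & \displaystyle\max_{\boldsymbol\xi\in\Xi(\boldsymbol w,\overline{\boldsymbol\xi})}\ \boldsymbol c^\top\boldsymbol\psi+\boldsymbol\xi^\top\boldsymbol C\boldsymbol x+\boldsymbol\xi^\top\boldsymbol D\boldsymbol w+\boldsymbol\xi^\top\boldsymbol Q\boldsymbol y^k-\boldsymbol\psi^\top\boldsymbol g(\boldsymbol\xi)\\ \text{s.t.} & \boldsymbol T(\boldsymbol\xi)\boldsymbol x+\boldsymbol V(\boldsymbol\xi)\boldsymbol w+\boldsymbol W(\boldsymbol\xi)\boldsymbol y^k\le\boldsymbol H\boldsymbol\xi\quad\forall\boldsymbol\xi\in\Xi(\boldsymbol w,\overline{\boldsymbol\xi})\end{array}\right\}\\ \text{s.t.} & \boldsymbol\psi\in\mathbb R_+^{N_g},\ \boldsymbol x\in\mathcal X,\ \boldsymbol w\in\mathcal W,\ \boldsymbol y^k\in\mathcal Y\quad\forall k\in\mathcal K \end{array} $$ has an equivalent mixed binary bilinear reformulation.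
   Context: Data: $K\ge1$ an integer, $\mathcal K=\{1,\dots,K\}$; $\mathcal X\subseteq\mathbb R^{N_x}$, $\mathcal Y\subseteq\mathbb R^{N_y}$ (both may involve integrality constraints), $\mathcal W\subseteq\{0,1\}^{N_\xi}$; matrices $\boldsymbol C\in\mathbb R^{N_\xi\times N_x}$, $\boldsymbol D\in\mathbb R^{N_\xi\times N_\xi}$, $\boldsymbol Q\in\mathbb R^{N_\xi\times N_y}$, $\boldsymbol H\in\mathbb R^{L\times N_\xi}$; maps $\boldsymbol T(\boldsymbol\xi)\in\mathbb R^{L\times N_x}$, $\boldsymbol V(\boldsymbol\xi)\in\mathbb R^{L\times N_\xi}$, $\boldsymbol W(\boldsymbol\xi)\in\mathbb R^{L\times N_y}$ linear in $\boldsymbol\xi$. $\Xi=\{\boldsymbol\xi\in\mathbb R^{N_\xi}:\boldsymbol A\boldsymbol\xi\le\boldsymbol b\}$, with $\boldsymbol A\in\mathbb R^{R\times N_\xi}$, $\boldsymbol b\in\mathbb R^R$, is a nonempty bounded polyhedron; $\Xi(\boldsymbol w,\overline{\boldsymbol\xi})=\{\boldsymbol\xi\in\Xi:\boldsymbol w\circ\boldsymbol\xi=\boldsymbol w\circ\overline{\boldsymbol\xi}\}$, with $\circ$ the Hadamard (componentwise) product. $\boldsymbol c\in\mathbb R^{N_g}$, and $\boldsymbol g:\mathbb R^{N_\xi}\to\mathbb R^{N_g}$ is given by $g_s(\boldsymbol\xi)=\max_{t\in\mathcal T}\boldsymbol g_{st}^\top\boldsymbol\xi$ for $s\in\mathcal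 S=\{1,\dots,N_g\}$, $\mathcal T=\{1,\dots,T\}$, $\boldsymbol g_{st}\in\mathbb R^{N_\xi}$. Standing assumption: there is a measure $\mathbb P\in\mathcal M_+(\mathbb R^{N_\xi})$ (nonnegative Borel measures) with $\mathbb P(\boldsymbol\xi\in\Xi)=1$, $\mathbb E_{\mathbb P}(\boldsymbol g(\boldsymbol\xi))\le\boldsymbol c$, and $\mathbb E_{\mathbb P}[g_s(\boldsymbol\xi)]<c_s$ for all $s$ for which $g_s$ is nonlinear. Conventions: ''min'' and ''max'' mean infimum and supremum when the optimum is not attained. If for some $\overline{\boldsymbol\xi}\in\Xi$ no $k\in\mathcal K$ satisfies the inner constraints, the inner problem has value $+\infty$. A mixed binary bilinear reformulation is an optimization problem over the variables $\boldsymbol x\in\mathcal X$, $\boldsymbol w\in\mathcal W$, $\boldsymbol y^k\in\mathcal Y$ ($k\in\mathcal K$), $\boldsymbol\psi\in\mathbb R_+^{N_g}$ and finitely many additional real or binary auxiliary variables, whose objective function and finitely many further (in)equality constraints involve only constant terms, linear terms, and products of two decision variables. It is equivalent to the given problem if it has the same optimal value and if $(\boldsymbol\psi,\boldsymbol x,\boldsymbol w,\{\boldsymbol y^k\}_{k\in\mathcal K})$ is optimal in the given problem if and only if it can be completed by auxiliary variables to an optimal solution of the reformulation. *)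

(* Defs.v *)
(* MathComp-Analysis, over an arbitrary [R : realType].  R^n is ['cV[R]_n]. *)
From HB Require Import structures.
From mathcomp Require Import all_boot all_order all_algebra.
From mathcomp Require Import all_classical all_reals all_analysis.
Set Implicit Arguments.
Unset Strict Implicit.
Unset Printing Implicit Defensive.
Import Order.TTheory GRing.Theory Num.Theory.
Import numFieldNormedType.Exports.
Local Open Scope classical_set_scope.
Local Open Scope ring_scope.

Section Vectors.
Variables (R : realType) (n : nat).
Implicit Types u v : 'cV[R]_n.

Definition vle u v : Prop := forall i, u i 0 <= v i 0.

Definition dot u v : R := (u^T *m v) 0 0.

Definition hadamard u v : 'cV[R]_n := map2_mx *%R u v.

Definition binary v : Prop := forall i, v i 0 = 0 \/ v i 0 = 1.

End Vectors.

(* Minimization of an extended-real cost [f] over a set [S].  A point of cost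
   +oo counts as infeasible, so it is never optimal; an infeasible problem has
   value +oo. *)
Section Optimization.
Variables (R : realType) (U : Type) (S : set U) (f : U -> \bar R).

Definition opt_value : \bar R := ereal_inf (f @` S).

Definition optimal (z : U) : Prop :=
  [/\ S z, (f z < +oo)%E & forall z', S z' -> (f z <= f z')%E].

End Optimization.

Record data (R : realType) (K Nx Ny Nxi L nR Ng nT : nat) := Data {
  setX : set 'cV[R]_Nx;
  setY : set 'cV[R]_Ny;
  setW : set 'cV[R]_Nxi;
  matC : 'M[R]_(Nxi, Nx);
  matD : 'M[R]_(Nxi, Nxi);
  matQ : 'M[R]_(Nxi, Ny);
  matH : 'M[R]_(L, Nxi);
  mapT : {linear 'cV[R]_Nxi -> 'M[R]_(L, Nx)};
  mapV : {linear 'cV[R]_Nxi -> 'M[R]_(L, Nxi)};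
  mapW : {linear 'cV[R]_Nxi -> 'M[R]_(L, Ny)};
  matA : 'M[R]_(nR, Nxi);
  vecb : 'cV[R]_nR;
  vecc : 'cV[R]_Ng;
  vecg : 'I_Ng -> 'I_nT -> 'cV[R]_Nxi
}.

Record decision (R : realType) (K Nx Ny Nxi Ng : nat) := Decision {
  dpsi : 'cV[R]_Ng;
  dx : 'cV[R]_Nx;
  dw : 'cV[R]_Nxi;
  dy : 'I_K -> 'cV[R]_Ny
}.

Section KAdaptability.
Variables (R : realType) (K Nx Ny Nxi L nR Ng nT : nat).
Variable P : data R K Nx Ny Nxi L nR Ng nT.
Local Notation dec := (decision R K Nx Ny Nxi Ng).
Implicit Types (d : dec) (k : 'I_K) (w xi xibar : 'cV[R]_Nxi).

Definition Xi : set 'cV[R]_Nxi := [set xi | vle (matA P *m xi) (vecb P)].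

Definition XiW w xibar : set 'cV[R]_Nxi :=
  [set xi | Xi xi /\ hadamard w xi = hadamard w xibar].

(* The supremum is a maximum over the finite set of pieces, nonempty when
   [0 < nT]. *)
Definition gfun xi : 'cV[R]_Ng :=
  \col_s sup (range (fun t : 'I_nT => dot (vecg P s t) xi)).

Definition payoff d k xi : R :=
  dot (vecc P) (dpsi d) + dot xi (matC P *m dx d) + dot xi (matD P *m dw d)
  + dot xi (matQ P *m dy d k) - dot (dpsi d) (gfun xi).

Definition robust_feasible d k xibar : Prop :=
  forall xi, XiW (dw d) xibar xi ->
    vle (mapT P xi *m dx d + mapV P xi *m dw d + mapW P xi *m dy d k)
        (matH P *m xi).

Definition policy_value d k xibar : \bar R :=
  ereal_sup [set (payoff d k xi)%:E | xi in XiW (dw d) xibar].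

(* [ereal_inf set0 = +oo]: the value when no policy is robustly feasible. *)
Definition inner_value d xibar : \bar R :=
  ereal_inf [set policy_value d k xibar | k in [set k | robust_feasible d k xibar]].

Definition kadapt_cost d : \bar R := ereal_sup [set inner_value d xibar | xibar in Xi].

Definition kadapt_dom : set dec :=
  [set d | [/\ vle 0 (dpsi d), setX P (dx d), setW P (dw d)
             & forall k, setY P (dy d k)]].

(* Borel measures on R^Nxi: measures on the sigma-algebra generated by the
   open sets.  [mu] need not be finite; the integral is over the whole space. *)
Definition moment_condition : Prop :=
  exists mu : {measure set (g_sigma_algebraType (@open 'cV[R]_Nxi)) -> \bar R},
  [/\ mu Xi = 1%E,
      forall s, (\int[mu]_xi (gfun xi s 0)%:E <= (vecc P s 0)%:E)%E
    & forall s, ~ scalar (fun xi => gfun xi s 0) ->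
        (\int[mu]_xi (gfun xi s 0)%:E < (vecc P s 0)%:E)%E].

End KAdaptability.

(* Constant and linear terms, and products of two distinct variables; both
   orders of a pair may carry a coefficient. *)
Record bilinear_expr (R : realType) (I : finType) := BilinearExpr {
  bl_const : R;
  bl_lin : I -> R;
  bl_prod : I -> I -> R
}.

Definition bl_eval (R : realType) (I : finType) (e : bilinear_expr R I)
    (z : I -> R) : R :=
  bl_const e + \sum_i bl_lin e i * z i
  + \sum_i \sum_(j | j != i) bl_prod e i j * (z i * z j).

(* Indices of the scalar decision variables, in order: psi, x, w, the y^k,
   the real and the binary auxiliary variables. *)
Definition dvar (K Nx Ny Nxi Ng nreal nbin : nat) : finType :=
  ('I_Ng + 'I_Nx + 'I_Nxi + 'I_K * 'I_Ny + 'I_nreal + 'I_nbin)%type.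

Record reformulation (R : realType) (K Nx Ny Nxi Ng : nat) := Reformulation {
  nreal : nat;
  nbin : nat;
  rf_obj : bilinear_expr R (dvar K Nx Ny Nxi Ng nreal nbin);
  rf_ineqs : seq (bilinear_expr R (dvar K Nx Ny Nxi Ng nreal nbin));
  rf_eqs : seq (bilinear_expr R (dvar K Nx Ny Nxi Ng nreal nbin))
}.

Section Reformulation.
Variables (R : realType) (K Nx Ny Nxi L nR Ng nT : nat).
Variable P : data R K Nx Ny Nxi L nR Ng nT.
Variable F : reformulation R K Nx Ny Nxi Ng.
Local Notation dec := (decision R K Nx Ny Nxi Ng).
Local Notation var := (dvar K Nx Ny Nxi Ng (nreal F) (nbin F)).

Definition completion := (dec * ('cV[R]_(nreal F) * 'cV[R]_(nbin F)))%type.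

Definition assignment (z : completion) (i : var) : R :=
  let: (d, (r, v)) := z in
  match i with
  | inl (inl (inl (inl (inl s)))) => dpsi d s 0
  | inl (inl (inl (inl (inr j)))) => dx d j 0
  | inl (inl (inl (inr j))) => dw d j 0
  | inl (inl (inr (k, j))) => dy d k j 0
  | inl (inr a) => r a 0
  | inr a => v a 0
  end.

Definition rf_dom : set completion :=
  [set z | [/\ kadapt_dom P z.1, binary z.2.2,
     all (fun e => bl_eval e (assignment z) <= 0) (rf_ineqs F)
   & all (fun e => bl_eval e (assignment z) == 0) (rf_eqs F)]].

Definition rf_cost (z : completion) : \bar R :=
  (bl_eval (rf_obj F) (assignment z))%:E.

Definition equivalent_reformulation : Prop :=
  opt_value (kadapt_dom P) (kadapt_cost P) = opt_value rf_dom rf_cost /\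
  forall d : dec,
    optimal (kadapt_dom P) (kadapt_cost P) d <->
    exists a, optimal rf_dom rf_cost (d, a).

End Reformulation.

(* Main.v *)
(* The epigraph of the cost is first-order definable over the reals:
   cost(d) <= tau iff for every xibar in Xi some k satisfies, for every xi in
   Xi(w, xibar), the constraints and payoff <= tau, all of which are polynomial
   inequalities once g(xi) is replaced by a variable u constrained to be the
   componentwise maximum.  By Tarski's quantifier elimination over real closed
   fields the epigraph is then given by a boolean combination of polynomial
   inequalities.  The 0/1-valued characteristic function of such a combination
   is the output of an arithmetic circuit whose gates are bilinear equations in
   auxiliary real variables.  Minimizing tau subject to the circuit having
   output 1 is the reformulation. *)
Require Import Defs.
From mathcomp Require Import all_boot all_order all_algebra.
From mathcomp Require Import all_classical all_reals all_analysis.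
From mathcomp Require Import ordered_qelim lra.
From mathcomp Require qe_rcf.
Set Implicit Arguments.
Unset Strict Implicit.
Unset Printing Implicit Defensive.
Import Order.TTheory GRing.Theory Num.Theory.
Import numFieldNormedType.Exports.
Local Open Scope classical_set_scope.
Local Open Scope ring_scope.

(** * Bilinear functions and circuits *)

Section Bilinear.
Variables (R : realType) (I : finType).
Implicit Types (f g : (I -> R) -> R) (i j : I) (c : R).

(** The extensional form of [bilinear_expr], so that closure properties need no coefficients. *)
Definition bilinear_fun f := exists e : bilinear_expr R I, bl_eval e =1 f.

Lemma bilinear_const c : bilinear_fun (fun=> c).
Proof.
exists (BilinearExpr c (fun=> 0) (fun _ _ => 0)) => z; rewrite /bl_eval /=.
rewrite big1 => [|i _]; last by rewrite mul0r.
by rewrite big1 ?addr0 // => i _; rewrite big1 // => j _; rewrite mul0r.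
Qed.

Lemma bilinear_var i : bilinear_fun (fun z => z i).
Proof.
exists (BilinearExpr 0 (fun j => (j == i)%:R) (fun _ _ => 0)) => z.
rewrite /bl_eval /= add0r (bigD1 i) //= eqxx mul1r.
rewrite big1 => [|j /negPf->]; last by rewrite mul0r.
by rewrite big1 ?addr0 // => k _; rewrite big1 // => j _; rewrite mul0r.
Qed.

(** [bl_eval] sums over pairs of distinct indices, so a square has to be written as the product of a
    variable and a copy of it. *)
Lemma bilinear_mul i j : i != j -> bilinear_fun (fun z => z i * z j).
Proof.
move=> nij.
exists (BilinearExpr 0 (fun=> 0) (fun k l => ((k == i) && (l == j))%:R)) => z.
rewrite /bl_eval /= add0r big1 ?add0r => [|k _]; last by rewrite mul0r.
rewrite (bigD1 i) //= [X in _ + X]big1 ?addr0 => [|k /negPf->]; last first.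
  by rewrite big1 // => l _; rewrite mul0r.
rewrite (bigD1 j) 1?eq_sym //= !eqxx mul1r big1 ?addr0 // => l /andP[_ /negPf->].
by rewrite andbF mul0r.
Qed.

Lemma bilinear_add f g :
  bilinear_fun f -> bilinear_fun g -> bilinear_fun (fun z => f z + g z).
Proof.
move=> [e ef] [e' eg]; exists (BilinearExpr (bl_const e + bl_const e')
  (fun i => bl_lin e i + bl_lin e' i)
  (fun i j => bl_prod e i j + bl_prod e' i j)) => z.
rewrite -ef -eg /bl_eval /=.
under eq_bigr do rewrite mulrDl.
under [X in _ + X = _]eq_bigr do
  (under eq_bigr do rewrite mulrDl; rewrite big_split /=).
by rewrite !big_split /= [RHS]addrACA [X in _ = X + _]addrACA.
Qed.

Lemma bilinear_scale c f : bilinear_fun f -> bilinear_fun (fun z => c * f z).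
Proof.
move=> [e ef]; exists (BilinearExpr (c * bl_const e)
  (fun i => c * bl_lin e i) (fun i j => c * bl_prod e i j)) => z.
rewrite -ef /bl_eval /= !mulrDr !big_distrr /=; congr (_ + _ + _).
  by apply: eq_bigr => i _; rewrite mulrA.
apply: eq_bigr => i _; rewrite big_distrr /=.
by apply: eq_bigr => j _; rewrite -mulrA.
Qed.

Lemma bilinear_opp f : bilinear_fun f -> bilinear_fun (fun z => - f z).
Proof.
move/(bilinear_scale (-1)) => [e ef]; exists e => z.
by rewrite ef mulN1r.
Qed.

Lemma bilinear_sum (J : finType) (P : pred J) (F : J -> (I -> R) -> R) :
  (forall k, P k -> bilinear_fun (F k)) ->
  bilinear_fun (fun z => \sum_(k | P k) F k z).
Proof.
move=> bF.
suff [e ee] : bilinear_fun (\sum_(k | P k) F k).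
  by exists e => z; rewrite ee fct_sumE.
apply: (big_ind bilinear_fun); [exact: bilinear_const| |exact: bF].
by move=> f g bf bg; exact: bilinear_add.
Qed.

End Bilinear.

(** Injectivity of [h] keeps distinct variables distinct, so no product becomes a square. *)
Lemma bilinear_reindex (R : realType) (I J : finType) (h : I -> J)
    (f : (I -> R) -> R) :
  injective h -> bilinear_fun f -> bilinear_fun (fun z => f (z \o h)).
Proof.
move=> hI [e ef].
suff [e' e'E] : bilinear_fun (fun z : J -> R => bl_eval e (z \o h)).
  by exists e' => z; rewrite e'E ef.
apply: bilinear_add; first apply: bilinear_add.
- exact: bilinear_const.
- by apply: bilinear_sum => i _; apply/bilinear_scale/bilinear_var.
- apply: bilinear_sum => i _; apply: bilinear_sum => j ji.
  by apply/bilinear_scale/bilinear_mul; rewrite (inj_eq hI) eq_sym.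
Qed.

Ltac bilinear := repeat first
  [ exact: bilinear_const | exact: bilinear_var
  | by apply: bilinear_mul | apply: bilinear_add | apply: bilinear_opp
  | apply: bilinear_scale ].

(** * Circuits with bilinear gates *)

Section Circuit.
Variable R : realType.

(* Input variables I, auxiliary variables [aux], bilinear equations
   [gate l = 0]. *)
Record circuit (I : finType) := Circuit {
  aux : finType;
  label : finType;
  gate : label -> (I + aux -> R) -> R;
  gate_bilinear : forall l, bilinear_fun (gate l);
  out : aux }.

Definition join (I J : Type) (z : I -> R) (r : J -> R) (i : I + J) : R :=
  match i with inl i => z i | inr j => r j end.

Definition solution I (C : circuit I) (z : I -> R) (r : aux C -> R) : Prop :=
  forall l, gate l (join z r) = 0.

(** Every input has a solution, so the circuit never restricts its inputs. Only the output is
    determined; the other auxiliary variables may take several values. *)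
Definition computes I (C : circuit I) (p : (I -> R) -> R) : Prop :=
  forall z, (exists r : aux C -> R, solution z r) /\
            forall r : aux C -> R, solution z r -> r (out C) = p z.

Definition computable (I : finType) p := exists C : circuit I, computes C p.

(** * Composition of circuits *)

Section Substitution.
Variables (I J : finType) (D : circuit J) (C : J -> circuit I).

Let aux_subst : finType := ({j : J & aux (C j)} + aux D)%type.

Let in_sub j (k : I + aux (C j)) : I + aux_subst :=
  match k with
  | inl i => inl i
  | inr a => inr (inl (Tagged (fun j => aux (C j)) a))
  end.

Let in_main (k : J + aux D) : I + aux_subst :=
  match k with
  | inl j => inr (inl (Tagged (fun j => aux (C j)) (out (C j))))
  | inr a => inr (inr a)
  end.

Let in_sub_inj j : injective (@in_sub j).
Proof.
move=> [i|a] [i'|a'] //= [] => [->//|/eqP].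
by rewrite -tag_eqE /tag_eq eqxx /= tagged_asE => /eqP ->.
Qed.

Let in_main_inj : injective in_main.
Proof. by move=> [j|a] [j'|a'] //= => [[->]|[->]]. Qed.

Let gate_subst (l : {j : J & label (C j)} + label D) (w : I + aux_subst -> R) :=
  match l with
  | inl l => gate (tagged l) (w \o @in_sub (tag l))
  | inr l => gate l (w \o in_main)
  end.

Let gate_subst_bilinear l : bilinear_fun (gate_subst l).
Proof.
case: l => l.
  exact: bilinear_reindex (@in_sub_inj _) (gate_bilinear _).
exact: bilinear_reindex in_main_inj (gate_bilinear _).
Qed.

Definition subst_circuit : circuit I :=
  Circuit gate_subst_bilinear (inr (out D) : aux_subst).

(** A solution of the composite restricts along [in_sub] to solutions of each [C j] and along
    [in_main] to a solution of [D]. The former force the wires entering [D] to carry [p j z], and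
    then the latter forces the output. *)
Lemma computes_subst q p :
  computes D q -> (forall j, computes (C j) (p j)) ->
  computes subst_circuit (fun z => q (fun j => p j z)).
Proof.
move=> Dq Cp z.
have subE j (r : aux_subst -> R) : join z r \o @in_sub j =
    join z (fun a => r (inl (Tagged (fun j => aux (C j)) a))).
  by apply/funext; case.
have mainE (r : aux_subst -> R) : join z r \o in_main =
    join (fun j => r (inl (Tagged (fun j => aux (C j)) (out (C j)))))
         (fun a => r (inr a)).
  by apply/funext; case.
split.
  pose s j := projT1 (cid (Cp j z).1).
  have sP j : solution z (s j) := projT2 (cid (Cp j z).1).
  have [r rP] := (Dq (fun j => p j z)).1.
  exists (fun k : aux_subst => match k with
    | inl a => s (tag a) (tagged a) | inr a => r a end).
  case=> [[j l]|l] /=; first by rewrite subE; exact: sP.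
  rewrite mainE /= (_ : (fun j => _) = fun j => p j z); first exact: rP.
  by apply/funext => j; exact: (Cp j z).2 _ (sP j).
move=> r rP; have sE j : r (inl (Tagged (fun j => aux (C j)) (out (C j)))) = p j z.
  apply: (Cp j z).2 (fun a => r (inl (Tagged (fun j => aux (C j)) a))) _ => l.
  by have /= := rP (inl (Tagged (fun j => label (C j)) l)); rewrite subE.
apply: (Dq _).2 (fun a => r (inr a)) _ => l.
have /= := rP (inr l); rewrite mainE.
by rewrite (_ : (fun j => r _) = fun j => p j z) //; apply/funext.
Qed.

End Substitution.

Lemma computable_subst (I J : finType) (q : (J -> R) -> R)
    (p : J -> (I -> R) -> R) :
  computable q -> (forall j, computable (p j)) ->
  computable (fun z => q (fun j => p j z)).
Proof.
move=> [D Dq] /choice[C Cp]; exists (subst_circuit D C).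
exact: computes_subst.
Qed.

(** Unfolds by computation, so that a concrete list of gates becomes an explicit conjunction. *)
Definition conj_all T (Q : T -> Prop) : seq T -> Prop :=
  foldr (fun x => and (Q x)) True.

Lemma conj_allP T (Q : T -> Prop) (s : seq T) :
  conj_all Q s <-> forall l : 'I_(size s), Q (tnth (in_tuple s) l).
Proof.
elim: s => [|x s IH]; first by split=> // _ [].
split=> [[Qx /IH Qs] l|Qs]; last first.
  split; first exact: Qs ord0.
  apply/IH => l; have := Qs (lift ord0 l).
  by rewrite !(tnth_nth x).
case: (unliftP ord0 l) => [l' ->|->]; rewrite (tnth_nth x) //=.
by have := Qs l'; rewrite (tnth_nth x).
Qed.

(** The gates are labelled by their positions in the list. *)
Lemma computable_gates (I J : finType) (gates : seq ((I + J -> R) -> R))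
    (o : J) (p : (I -> R) -> R) :
  conj_all (@bilinear_fun R _) gates ->
  (forall z, exists r, conj_all (fun g => g (join z r) = 0) gates) ->
  (forall z r, conj_all (fun g => g (join z r) = 0) gates -> r o = p z) ->
  computable p.
Proof.
move=> /conj_allP gb ge gu; exists (Circuit gb o) => z; split.
  by have [r /conj_allP rP] := ge z; exists r.
by move=> r rP; apply: gu; apply/conj_allP.
Qed.

(** * Elementary circuits: arithmetic, zero test, absolute value, sign *)

Lemma computable_const (I : finType) c : computable (fun _ : I -> R => c).
Proof.
apply: (computable_gates (gates := [:: fun w => w (inr tt) - c]) (o := tt)) => /=.
- by split=> //; bilinear.
- by move=> z; exists (fun=> c); rewrite subrr.
- by move=> z r [/subr0_eq].
Qed.

Lemma computable_var (I : finType) (i : I) : computable (fun z : I -> R => z i).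
Proof.
apply: (computable_gates
  (gates := [:: fun w => w (inr tt) - w (inl i)]) (o := tt)) => /=.
- by split=> //; bilinear.
- by move=> z; exists (fun=> z i); rewrite subrr.
- by move=> z r [/subr0_eq].
Qed.

(** By substitution, a gate is needed only for formal operands: [true] indexes the first and [false]
    the second. *)
Lemma computable_op2 (I : finType) (q : R -> R -> R) (p p' : (I -> R) -> R) :
  computable (fun z : bool -> R => q (z true) (z false)) ->
  computable p -> computable p' -> computable (fun z => q (p z) (p' z)).
Proof.
move=> cq cp cp'.
by apply: (computable_subst (p := fun b : bool => if b then p else p') cq); case.
Qed.

Lemma computable_op1 (I : finType) (q : R -> R) (p : (I -> R) -> R) :
  computable (fun z : unit -> R => q (z tt)) ->
  computable p -> computable (fun z => q (p z)).
Proof. by move=> cq cp; exact: (computable_subst (p := fun=> p) cq). Qed.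

Lemma computable_add (I : finType) (p q : (I -> R) -> R) :
  computable p -> computable q -> computable (fun z => p z + q z).
Proof.
apply: computable_op2; apply: (computable_gates (o := tt)
  (gates := [:: fun w => w (inr tt) - (w (inl true) + w (inl false))])) => /=.
- by split=> //; bilinear.
- by move=> z; exists (fun=> z true + z false); rewrite subrr.
- by move=> z r [/subr0_eq].
Qed.

(** The operands enter through two distinct input variables, so the gate is admissible even when [p]
    and [q] coincide. *)
Lemma computable_mul (I : finType) (p q : (I -> R) -> R) :
  computable p -> computable q -> computable (fun z => p z * q z).
Proof.
apply: computable_op2; apply: (computable_gates (o := tt)
  (gates := [:: fun w => w (inr tt) - (w (inl true) * w (inl false))])) => /=.
- by split=> //; bilinear.
- by move=> z; exists (fun=> z true * z false); rewrite subrr.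
- by move=> z r [/subr0_eq].
Qed.

(** With input [x], output [e] and auxiliary [v], the gates read [x * e = 0] and [1 - e = x * v]. If
    [x = 0], the second gives [e = 1] for any [v]; otherwise the first gives [e = 0], and [v = x^-1]
    completes the solution. *)
Lemma computable_eq0 (I : finType) (p : (I -> R) -> R) :
  computable p -> computable (fun z => (p z == 0)%:R).
Proof.
apply: (computable_op1 (q := fun x => (x == 0)%:R)).
apply: (computable_gates (o := true)
  (gates := [:: fun w => w (inl tt) * w (inr true);
                fun w => (1 - w (inr true)) - w (inl tt) * w (inr false)])) => /=.
- by do !split=> //; bilinear.
- move=> z; exists (fun b => if b then (z tt == 0)%:R else (z tt)^-1).
  have [->|z0] := eqVneq (z tt) 0; first by rewrite !mul0r !subrr.
  by rewrite mulr0 subr0 divff // subrr.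
- move=> z r [zr [/subr0_eq rz _]]; have [z0|z0] := eqVneq (z tt) 0.
    by move/eqP: rz; rewrite z0 mul0r subr_eq0 => /eqP <-.
  by move/eqP: zr; rewrite mulf_eq0 (negPf z0) => /eqP.
Qed.

(* With [s = +-1] and [s * p = b ^ 2], the value [s * p] is [`|p|]. *)
Lemma computable_norm (I : finType) (p : (I -> R) -> R) :
  computable p -> computable (fun z => `|p z|).
Proof.
(* [s'] and [b'] are copies of [s] and [b], used to express the squares [s ^ 2 = 1] and [b ^ 2];
   [None] is the output. *)
pose s : bool * bool := (true, true); pose s' : bool * bool := (true, false).
pose b : bool * bool := (false, true); pose b' : bool * bool := (false, false).
apply: (computable_op1 (q := fun x => `|x|)).
apply: (computable_gates (o := None)
  (gates := [:: fun w => w (inr (Some s)) - w (inr (Some s'));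
                fun w => w (inr (Some s)) * w (inr (Some s')) - 1;
                fun w => w (inr (Some b)) - w (inr (Some b'));
                fun w => w (inr None) - w (inr (Some b)) * w (inr (Some b'));
                fun w => w (inr None) - w (inr (Some s)) * w (inl tt)])) => /=.
- by do !split=> //; bilinear.
- move=> z; exists (fun k => match k with None => `|z tt|
    | Some (true, _) => if 0 <= z tt then 1 else -1
    | Some (false, _) => Num.sqrt `|z tt| end).
  rewrite /= -!expr2 sqr_sqrtr // !subrr; case: ger0P => _.
    by rewrite expr1n mul1r !subrr.
  by rewrite sqrrN expr1n mulN1r !subrr.
- move=> z r [/subr0_eq <- [/subr0_eq/eqP]].
  rewrite -expr2 sqrf_eq1 => ss [/subr0_eq <- [/subr0_eq rb [/subr0_eq rs _]]].
  have r0 : 0 <= r None by rewrite rb -expr2 sqr_ge0.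
  rewrite -(ger0_norm r0) rs normrM.
  by case/orP: ss => /eqP ->; rewrite ?normrN normr1 mul1r.
Qed.

Lemma computable_ext (I : finType) (p q : (I -> R) -> R) :
  p =1 q -> computable p -> computable q.
Proof. by move=> /funext ->. Qed.

(** A real is nonnegative exactly when it equals its absolute value, which reduces the sign to a
    zero test. *)
Lemma computable_ge0 (I : finType) (p : (I -> R) -> R) :
  computable p -> computable (fun z => (0 <= p z)%R%:R).
Proof.
move=> cp; apply: (computable_ext (p := fun z => (`|p z| + -1 * p z == 0)%R%:R)).
  by move=> z; rewrite mulN1r subr_eq0 ger0_def.
apply/computable_eq0/computable_add; first exact: computable_norm.
by apply: computable_mul => //; exact: computable_const.
Qed.

End Circuit.

(** * Quantifier-free formulas and definable sets *)

Section QuantifierFree.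
Variables (R : realType) (I : finType).
Implicit Types (z : I -> R) (t : GRing.term R) (f : ord.formula R).

Let env z : seq R := [seq z i | i <- enum I].

Lemma computable_term t :
  GRing.rterm t -> computable (fun z => GRing.eval (env z) t).
Proof.
elim: t => //=.
(* A variable whose index exceeds the list evaluates to the default 0. *)
- move=> n _; have [nI|nI] := ltnP n (size (enum I)); last first.
    apply: (computable_ext (p := fun=> 0)); last exact: computable_const.
    by move=> z; rewrite nth_default // size_map.
  have i0 : I by case: (enum I) nI.
  apply: (computable_ext _ (computable_var R (nth i0 (enum I) n))) => z.
  by rewrite [RHS](nth_map i0).
- by move=> c _; exact: computable_const.
- by move=> n _; exact: computable_const.
- by move=> t IHt u IHu /andP[/IHt ct /IHu cu]; exact: computable_add.
- move=> t IHt /IHt ct.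
  apply: (computable_ext (p := fun z => -1 * GRing.eval (env z) t)).
    by move=> z; rewrite mulN1r.
  by apply: computable_mul => //; exact: computable_const.
- move=> t IHt n /IHt ct.
  apply: (computable_ext (p := fun z => GRing.eval (env z) t * n%:R)).
    by move=> z; rewrite mulr_natr.
  by apply: computable_mul => //; exact: computable_const.
- by move=> t IHt u IHu /andP[/IHt ct /IHu cu]; exact: computable_mul.
- move=> t IHt n /IHt ct; elim: n => [|n IHn].
    by apply: (computable_ext _ (computable_const I 1)) => z; rewrite expr0.
  by apply: (computable_ext _ (computable_mul ct IHn)) => z; rewrite exprS.
Qed.

Lemma computable_not (b : (I -> R) -> bool) :
  computable (fun z => (b z)%:R) -> computable (fun z => (~~ b z)%:R).
Proof.
move=> cb; apply: (computable_ext (p := fun z => 1 + -1 * (b z)%:R)).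
  by move=> z; case: (b z) => /=; rewrite ?mulr0 ?addr0 // mulr1 subrr.
apply: computable_add; first exact: computable_const.
by apply: computable_mul => //; exact: computable_const.
Qed.

Lemma computable_and (a b : (I -> R) -> bool) :
  computable (fun z => (a z)%:R) -> computable (fun z => (b z)%:R) ->
  computable (fun z => (a z && b z)%:R).
Proof.
move=> ca cb; apply: (computable_ext _ (computable_mul ca cb)) => z.
by rewrite -natrM mulnb.
Qed.

Lemma computable_sub (p q : (I -> R) -> R) :
  computable p -> computable q -> computable (fun z => p z - q z).
Proof.
move=> cp cq; apply: (computable_ext (p := fun z => p z + -1 * q z)).
  by move=> z; rewrite mulN1r.
apply: computable_add => //.
by apply: computable_mul => //; exact: computable_const.
Qed.

(** Truth values are the reals 0 and 1. All connectives come from negation and conjunction, and a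
    strict inequality is the negation of the reverse weak one. *)
Lemma computable_qf_formula f : ord.qf_form f -> ord.rformula f ->
  computable (fun z => (ord.qf_eval (env z) f)%:R).
Proof.
elim: f => //=.
- by move=> b _ _; exact: computable_const.
- move=> t u _ /andP[/computable_term ct /computable_term cu].
  by apply: (computable_ext _ (computable_eq0 (computable_sub ct cu))) => z;
    rewrite subr_eq0.
- move=> t u _ /andP[/computable_term ct /computable_term cu].
  apply: (computable_ext _ (computable_not (computable_ge0 (computable_sub ct cu)))).
  by move=> z; rewrite subr_ge0 -ltNge.
- move=> t u _ /andP[/computable_term ct /computable_term cu].
  apply: (computable_ext _ (computable_ge0 (computable_sub cu ct))).
  by move=> z; rewrite subr_ge0.
- move=> f IHf g IHg /andP[qf qg] /andP[rf rg].
  by apply: computable_and; [exact: IHf|exact: IHg].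
- move=> f IHf g IHg /andP[qf qg] /andP[rf rg].
  apply: (computable_ext _ (computable_not (computable_and
    (computable_not (IHf qf rf)) (computable_not (IHg qg rg))))) => z.
  by rewrite -negb_or negbK.
- move=> f IHf g IHg /andP[qf qg] /andP[rf rg].
  apply: (computable_ext _ (computable_not (computable_and
    (IHf qf rf) (computable_not (IHg qg rg))))) => z.
  by rewrite negb_and negbK implybE.
- by move=> f IHf qf rf; apply: computable_not; exact: IHf.
Qed.

End QuantifierFree.

(** * First-order definability and quantifier elimination *)

Section Definability.
Variables (R : realType) (E : Type).
Implicit Types (c : seq (E -> R)) (p q : E -> R) (S : E -> Prop).

(** A point of [E] is visible to formulas only through the real coordinates listed in [c]; the
    position in the list is the variable number. *)
Definition env c (z : E) : seq R := [seq g z | g <- c].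

(* Polynomial functions of, and first-order properties of, the reals [g z]
   for [g] in the list [c]. *)
Definition polynomial_fun c p : Prop :=
  exists t : GRing.term R, forall z, GRing.eval (env c z) t = p z.

Definition definable c S : Prop :=
  exists f : ord.formula R, forall z, ord.holds (env c z) f <-> S z.

Lemma polynomial_coord c p : List.In p c -> polynomial_fun c p.
Proof.
move=> pc; suff [n ncE] : exists n, forall z, nth 0 (env c z) n = p z.
  by exists (GRing.Var _ n).
elim: c pc => //= g c IH [<-|/IH[n nE]]; first by exists 0%N.
by exists n.+1.
Qed.

Lemma polynomial_const c a : polynomial_fun c (fun=> a).
Proof. by exists (GRing.Const a). Qed.

Lemma polynomial_add c p q :
  polynomial_fun c p -> polynomial_fun c q -> polynomial_fun c (fun z => p z + q z).
Proof. by move=> [t tE] [u uE]; exists (GRing.Add t u) => z /=; rewrite tE uE. Qed.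

Lemma polynomial_mul c p q :
  polynomial_fun c p -> polynomial_fun c q -> polynomial_fun c (fun z => p z * q z).
Proof. by move=> [t tE] [u uE]; exists (GRing.Mul t u) => z /=; rewrite tE uE. Qed.

Lemma polynomial_opp c p : polynomial_fun c p -> polynomial_fun c (fun z => - p z).
Proof. by move=> [t tE]; exists (GRing.Opp t) => z /=; rewrite tE. Qed.

Lemma polynomial_sum c (I : finType) (p : I -> E -> R) :
  (forall i, polynomial_fun c (p i)) -> polynomial_fun c (fun z => \sum_i p i z).
Proof.
move=> cp; suff [t tE] : polynomial_fun c (\sum_i p i).
  by exists t => z; rewrite tE fct_sumE.
apply: (big_ind (polynomial_fun c)) => //; first exact: polynomial_const.
by move=> f g cf cg; exact: polynomial_add.
Qed.

Lemma definable_ext c S (S' : E -> Prop) : (forall z, S z <-> S' z) ->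
  definable c S -> definable c S'.
Proof. by move=> SS' [f fE]; exists f => z; rewrite -SS'. Qed.

Lemma definable_le c p q :
  polynomial_fun c p -> polynomial_fun c q -> definable c (fun z => p z <= q z).
Proof. by move=> [t tE] [u uE]; exists (ord.Le t u) => z /=; rewrite tE uE. Qed.

Lemma definable_eq c p q :
  polynomial_fun c p -> polynomial_fun c q -> definable c (fun z => p z = q z).
Proof. by move=> [t tE] [u uE]; exists (ord.Equal t u) => z /=; rewrite tE uE. Qed.

Lemma definable_and c S (S' : E -> Prop) :
  definable c S -> definable c S' -> definable c (fun z => S z /\ S' z).
Proof. by move=> [f fE] [g gE]; exists (ord.And f g) => z /=; rewrite fE gE. Qed.

Lemma definable_imp c S (S' : E -> Prop) :
  definable c S -> definable c S' -> definable c (fun z => S z -> S' z).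
Proof. by move=> [f fE] [g gE]; exists (ord.Implies f g) => z /=; rewrite fE gE. Qed.

Lemma definable_not c S : definable c S -> definable c (fun z => ~ S z).
Proof. by move=> [f fE]; exists (ord.Not f) => z /=; rewrite fE. Qed.

Lemma definable_forall_fin c (I : finType) (S : I -> E -> Prop) :
  (forall i, definable c (S i)) -> definable c (fun z => forall i, S i z).
Proof.
move=> /choice[f fE].
exists (foldr (fun i g => ord.And (f i) g) (ord.Bool true) (enum I)) => z.
suff H s : ord.holds (env c z) (foldr (fun i g => ord.And (f i) g)
    (ord.Bool true) s) <-> forall i, i \in s -> S i z.
  by rewrite H; split=> Sz i => [|_]; apply: Sz; rewrite ?mem_enum.
elim: s => //= i s ->; rewrite fE; split=> [[Si Ss] j|Ss].
  by rewrite inE => /predU1P[->//|/Ss].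
by split=> [|j js]; apply: Ss; rewrite inE ?eqxx ?js ?orbT.
Qed.

Lemma definable_exists_fin c (I : finType) (S : I -> E -> Prop) :
  (forall i, definable c (S i)) -> definable c (fun z => exists i, S i z).
Proof.
move=> cS; apply: (definable_ext (S := fun z => ~ forall i, ~ S i z)).
  by move=> z; rewrite -existsNE; split=> -[i]; exists i => //; exact: contrapT.
by apply/definable_not/definable_forall_fin => i; exact: definable_not.
Qed.

(** Tarski's theorem. [to_rform] first removes inverses, and [wproj] eliminates one existential
    quantifier in front of a conjunction of polynomial conditions. *)
Lemma definable_qf c S : definable c S ->
  exists f, [/\ ord.qf_form f, ord.rformula f
              & forall z, ord.qf_eval (env c z) f <-> S z].
Proof.
move=> [f fE]; have rf := ord.to_rform_rformula f.
pose wproj i bc : ord.formula R := qe_rcf.qfr_to_formula (qe_rcf.wproj i bc).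
exists (ord.quantifier_elim wproj (ord.to_rform f)).
have /andP[-> ->] := ord.quantifier_elim_wf (wproj := wproj)
  (@qe_rcf.wf_QE_wproj R) rf.
split=> // z; rewrite -fE -ord.to_rformP; apply: iff_sym; apply: rwP.
exact: (ord.quantifier_elim_rformP (wproj := wproj) (@qe_rcf.wf_QE_wproj R)
  (@qe_rcf.valid_QE_wproj R)).
Qed.

End Definability.

(** Serves to quantify all coordinates of a vector at once: successive updates of [e] are replaced
    by one environment [e']. *)
Lemma holds_foldExists (R : realType) (f : ord.formula R) s e :
  ord.holds e (foldr ord.Exists f s) <->
  exists2 e', {in [predC s], GRing.same_env e e'} & ord.holds e' f.
Proof.
elim: s e => [|i s IH] e /=.
  split=> [fe|[e' ee' fe']]; first by exists e.
  by apply: (ord.eq_holds _ fe') => j; rewrite ee'.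
split=> [[x /IH[e' ee' fe']]|[e' ee' fe']].
  exists e' => // j; rewrite !inE negb_or => /andP[ji js].
  by rewrite -ee' ?inE // nth_set_nth /= (negPf ji).
exists e'`_i; apply/IH; exists e' => // j js; rewrite nth_set_nth /=.
by case: eqVneq => [->//|ji]; rewrite ee' // !inE negb_or ji.
Qed.

(** * Quantification over vectors *)

Section Quantifiers.
Variables (R : realType) (E : Type) (n : nat).

(** Appending at the end preserves the variable numbers of [c]; the vector occupies the [n]
    positions from [size c] on. *)
Definition extend (c : seq (E -> R)) : seq (E * 'cV[R]_n -> R) :=
  [seq g \o fst | g <- c]
  ++ [seq (fun z : E * 'cV[R]_n => z.2 i 0) | i <- enum 'I_n].

Lemma definable_exists_vec c (S : E * 'cV[R]_n -> Prop) :
  definable (extend c) S -> definable c (fun z => exists v, S (z, v)).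
Proof.
move=> [f fE]; exists (foldr ord.Exists f (iota (size c) n)) => z.
have envE v : env (extend c) (z, v) = env c z ++ [seq v i 0 | i <- enum 'I_n].
  by rewrite /env map_cat -!map_comp.
have szE : size (env c z) = size c by rewrite size_map.
have szn (v : 'cV[R]_n) : size [seq v i 0 | i <- enum 'I_n] = n.
  by rewrite [LHS]size_map size_enum_ord.
rewrite holds_foldExists; split=> [[e ee fe]|[v Sv]]; last first.
  exists (env (extend c) (z, v)); last exact/fE.
  move=> j; rewrite !inE mem_iota negb_and -ltnNge -leqNgt envE nth_cat szE.
  case: ltnP => //= jc cj; rewrite !nth_default ?szE // szn.
  by rewrite leq_subRL.
(* The witness is read off the quantified positions of [e]. *)
exists (\col_i e`_(size c + i)); apply/fE.
apply: (ord.eq_holds _ fe) => j; rewrite envE nth_cat szE.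
case: ltnP => [jc|cj]; first by rewrite -ee // !inE mem_iota negb_and -ltnNge jc.
(* Beyond both blocks [e] agrees with [env c z], so both sides are the default 0. *)
have [jn|nj] := ltnP (j - size c) n; last first.
  rewrite [RHS]nth_default ?szn // -ee ?nth_default ?szE //.
  by rewrite !inE mem_iota negb_and -!leqNgt -leq_subRL // nj orbT.
rewrite [RHS](nth_map (Ordinal jn)) ?size_enum_ord // mxE nth_enum_ord //.
by rewrite subnKC.
Qed.

Lemma definable_forall_vec c (S : E * 'cV[R]_n -> Prop) :
  definable (extend c) S -> definable c (fun z => forall v, S (z, v)).
Proof.
move=> cS; apply: (definable_ext (S := fun z => ~ exists v, ~ S (z, v))).
  move=> z; rewrite -forallNE; split=> Sz v; first exact: contrapT.
  by apply; exact: Sz.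
apply/definable_not/(definable_exists_vec (S := fun w => ~ S w)).
exact: definable_not.
Qed.

Lemma extend_coord c p : List.In p c -> List.In (fun z => p z.1) (extend c).
Proof.
by move=> pc; apply/List.in_app_iff; left; exact: (List.in_map (fun g => g \o fst)).
Qed.

Lemma extend_coord_new c i : List.In (fun z : E * 'cV[R]_n => z.2 i 0) (extend c).
Proof.
apply/List.in_app_iff; right.
apply: (List.in_map (fun i (z : E * 'cV[R]_n) => z.2 i 0)).
have := mem_enum 'I_n i; elim: (enum 'I_n) => //= j s IH.
by rewrite inE => /predU1P[->|/IH]; [left|right].
Qed.

End Quantifiers.

(** * The epigraph of the cost *)

Section PolynomialMatrices.
Variables (R : realType) (E : Type) (c : seq (E -> R)).

Definition polynomial_mx m n (M : E -> 'M[R]_(m, n)) : Prop :=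
  forall i j, polynomial_fun c (fun z => M z i j).

Lemma polynomial_ext p q : p =1 q -> polynomial_fun c p -> polynomial_fun c q.
Proof. by move=> /funext ->. Qed.

Lemma polynomial_mx_const m n (A : 'M[R]_(m, n)) : polynomial_mx (fun=> A).
Proof. by move=> i j; exact: polynomial_const. Qed.

Lemma polynomial_mx_add m n (M N : E -> 'M[R]_(m, n)) :
  polynomial_mx M -> polynomial_mx N -> polynomial_mx (fun z => M z + N z).
Proof.
move=> cM cN i j; apply: (polynomial_ext _ (polynomial_add (cM i j) (cN i j))).
by move=> z; rewrite mxE.
Qed.

Lemma polynomial_mx_tr m n (M : E -> 'M[R]_(m, n)) :
  polynomial_mx M -> polynomial_mx (fun z => (M z)^T).
Proof. by move=> cM i j; apply: (polynomial_ext _ (cM j i)) => z; rewrite mxE. Qed.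

Lemma polynomial_mx_mul m n p (M : E -> 'M[R]_(m, n)) (N : E -> 'M[R]_(n, p)) :
  polynomial_mx M -> polynomial_mx N -> polynomial_mx (fun z => M z *m N z).
Proof.
move=> cM cN i j.
apply: (polynomial_ext (p := fun z => \sum_k M z i k * N z k j)).
  by move=> z; rewrite mxE.
by apply: polynomial_sum => k; exact: polynomial_mul.
Qed.

(** Expanding [v z] in the standard basis makes each entry a combination of its coordinates with
    constant coefficients. *)
Lemma polynomial_mx_linear n m p (f : {linear 'cV[R]_n -> 'M[R]_(m, p)})
    (v : E -> 'cV[R]_n) :
  polynomial_mx v -> polynomial_mx (fun z => f (v z)).
Proof.
move=> cv i j.
apply: (polynomial_ext (p := fun z => \sum_k v z k 0 * f (delta_mx k 0) i j)).
  move=> z; rewrite {2}(matrix_sum_delta (v z)) linear_sum summxE.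
  by apply: eq_bigr => k _; rewrite big_ord1 linearZ mxE.
by apply: polynomial_sum => k; apply: polynomial_mul (cv _ _) (polynomial_const _ _).
Qed.

Lemma polynomial_mx_hadamard n (u v : E -> 'cV[R]_n) :
  polynomial_mx u -> polynomial_mx v ->
  polynomial_mx (fun z => hadamard (u z) (v z)).
Proof.
move=> cu cv i j; apply: (polynomial_ext _ (polynomial_mul (cu i j) (cv i j))).
by move=> z; rewrite mxE.
Qed.

Lemma polynomial_dot n (u v : E -> 'cV[R]_n) :
  polynomial_mx u -> polynomial_mx v -> polynomial_fun c (fun z => dot (u z) (v z)).
Proof. by move=> cu cv; exact: (polynomial_mx_mul (polynomial_mx_tr cu) cv). Qed.

Lemma definable_vle n (u v : E -> 'cV[R]_n) :
  polynomial_mx u -> polynomial_mx v -> definable c (fun z => vle (u z) (v z)).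
Proof. by move=> cu cv; apply: definable_forall_fin => i; exact: definable_le. Qed.

Lemma definable_eq_vec n (u v : E -> 'cV[R]_n) :
  polynomial_mx u -> polynomial_mx v -> definable c (fun z => u z = v z).
Proof.
move=> cu cv; apply: (definable_ext (S := fun z => forall i, u z i 0 = v z i 0)).
  by move=> z; split=> [uv|->//]; apply/colP.
by apply: definable_forall_fin => i; exact: definable_eq.
Qed.

Lemma polynomial_mx_coord n (v : E -> 'cV[R]_n) :
  (forall i, List.In (fun z => v z i 0) c) -> polynomial_mx v.
Proof. by move=> cv i j; rewrite (ord1 j); exact: polynomial_coord. Qed.

End PolynomialMatrices.

(** Makes the supremum first-order: over a finite type it is an upper bound that is attained. The
    element [i0] makes the range nonempty. *)
Lemma eq_max (R : realType) (I : finType) (i0 : I) (f : I -> R) x :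
  x = sup (range f) <-> (forall i, f i <= x) /\ exists i, x = f i.
Proof.
suff maxE y : (forall i, f i <= y) /\ (exists i, y = f i) -> y = sup (range f).
  split=> [->|]; last exact: maxE.
  pose j := [arg max_(i > i0) f i]%O.
  have fj i : f i <= f j by rewrite /j; case: arg_maxP => // k _ kP; exact: kP.
  have <- : f j = sup (range f) by apply: maxE; split=> //; exists j.
  by split=> //; exists j.
move=> [fy [j yj]]; apply/eqP; rewrite eq_le; apply/andP; split.
  apply: ub_le_sup; last by exists j.
  by exists y => _ [i _ <-].
by apply: ge_sup; [exists (f i0), i0 | move=> _ [i _ <-]].
Qed.

Section Epigraph.
Variables (R : realType) (K Nx Ny Nxi L nR Ng nT : nat).
Variable P : data R K Nx Ny Nxi L nR Ng nT.
Hypothesis nT_gt0 : (0 < nT)%N.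
Local Notation dec := (decision R K Nx Ny Nxi Ng).

(** The summands of [dvar] before the auxiliary variables, nested as there, so that [inl (inl b)] is
    the matching variable of a reformulation. *)
Definition decision_index : finType :=
  ('I_Ng + 'I_Nx + 'I_Nxi + 'I_K * 'I_Ny)%type.

Definition decision_coord (d : dec) (b : decision_index) : R :=
  match b with
  | inl (inl (inl s)) => dpsi d s 0
  | inl (inl (inr j)) => dx d j 0
  | inl (inr j) => dw d j 0
  | inr (k, j) => dy d k j 0
  end.

(** Describes the graph of the piecewise linear [gfun] by finitely many linear conditions. *)
Lemma gfun_eq xi (u : 'cV[R]_Ng) :
  u = gfun P xi <-> forall s, (forall t, dot (vecg P s t) xi <= u s 0) /\
                              exists t, u s 0 = dot (vecg P s t) xi.
Proof.
split=> [-> s|uP]; last first.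
  by apply/colP => s; rewrite mxE; apply/(eq_max (Ordinal nT_gt0)); exact: uP.
by apply/(eq_max (Ordinal nT_gt0)); rewrite mxE.
Qed.

(* [payoff] with [u] in place of the non-polynomial [gfun P xi]. *)
Definition payoff_at (d : dec) (k : 'I_K) (xi : 'cV[R]_Nxi) (u : 'cV[R]_Ng) : R :=
  dot (vecc P) (dpsi d) + dot xi (matC P *m dx d) + dot xi (matD P *m dw d)
  + dot xi (matQ P *m dy d k) - dot (dpsi d) u.

Section Definable.
Variables (E : Type) (c : seq (E -> R)).

Lemma definable_Xi (v : E -> 'cV[R]_Nxi) :
  polynomial_mx c v -> definable c (fun z => Xi P (v z)).
Proof.
move=> cv; apply: definable_vle; last exact: polynomial_mx_const.
exact: polynomial_mx_mul (polynomial_mx_const _ _) cv.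
Qed.

Variable D : E -> dec.

(** [E] grows by a vector under each quantifier; the decision is therefore a function [D] of the
    current point, and its coordinates must stay available in [c]. *)
Definition decision_coords_in : Prop :=
  forall b, List.In (fun z => decision_coord (D z) b) c.

Hypothesis cD : decision_coords_in.

Lemma polynomial_dpsi : polynomial_mx c (fun z => dpsi (D z)).
Proof. by apply: polynomial_mx_coord => s; exact: (cD (inl (inl (inl s)))). Qed.

Lemma polynomial_dx : polynomial_mx c (fun z => dx (D z)).
Proof. by apply: polynomial_mx_coord => j; exact: (cD (inl (inl (inr j)))). Qed.

Lemma polynomial_dw : polynomial_mx c (fun z => dw (D z)).
Proof. by apply: polynomial_mx_coord => j; exact: (cD (inl (inr j))). Qed.

Lemma polynomial_dy k : polynomial_mx c (fun z => dy (D z) k).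
Proof. by apply: polynomial_mx_coord => j; exact: (cD (inr (k, j))). Qed.

Lemma definable_XiW (v v' : E -> 'cV[R]_Nxi) :
  polynomial_mx c v -> polynomial_mx c v' ->
  definable c (fun z => XiW P (dw (D z)) (v z) (v' z)).
Proof.
move=> cv cv'; apply: definable_and; first exact: definable_Xi.
by apply: definable_eq_vec; apply: polynomial_mx_hadamard => //; exact: polynomial_dw.
Qed.

Lemma definable_constraints k (xi : E -> 'cV[R]_Nxi) :
  polynomial_mx c xi ->
  definable c (fun z =>
    vle (mapT P (xi z) *m dx (D z) + mapV P (xi z) *m dw (D z)
         + mapW P (xi z) *m dy (D z) k) (matH P *m xi z)).
Proof.
move=> cxi; apply: definable_vle; last first.
  exact: polynomial_mx_mul (polynomial_mx_const _ _) cxi.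
have cT := polynomial_mx_linear (mapT P) cxi.
have cV := polynomial_mx_linear (mapV P) cxi.
have cW := polynomial_mx_linear (mapW P) cxi.
apply: polynomial_mx_add; first apply: polynomial_mx_add.
- exact: polynomial_mx_mul cT polynomial_dx.
- exact: polynomial_mx_mul cV polynomial_dw.
- exact: polynomial_mx_mul cW (polynomial_dy k).
Qed.

Lemma polynomial_payoff k (xi : E -> 'cV[R]_Nxi) (u : E -> 'cV[R]_Ng) :
  polynomial_mx c xi -> polynomial_mx c u ->
  polynomial_fun c (fun z => payoff_at (D z) k (xi z) (u z)).
Proof.
move=> cxi cu.
have cconst m n (A : 'M[R]_(m, n)) := polynomial_mx_const c A.
apply: polynomial_add; last exact: polynomial_opp (polynomial_dot polynomial_dpsi cu).
apply: polynomial_add; first apply: polynomial_add; first apply: polynomial_add.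
- exact: polynomial_dot (cconst _ _ _) polynomial_dpsi.
- exact: polynomial_dot cxi (polynomial_mx_mul (cconst _ _ _) polynomial_dx).
- exact: polynomial_dot cxi (polynomial_mx_mul (cconst _ _ _) polynomial_dw).
- exact: polynomial_dot cxi (polynomial_mx_mul (cconst _ _ _) (polynomial_dy k)).
Qed.

End Definable.

Lemma decision_coords_extend E n (c : seq (E -> R)) (D : E -> dec) :
  decision_coords_in c D -> decision_coords_in (extend n c) (fun z => D z.1).
Proof. by move=> cD b; exact: (extend_coord _ (cD b)). Qed.

(** Exactly one [u] equals [gfun P (xi z)], so the bound on the payoff may be stated for every such
    [u]. *)
Lemma definable_payoff_le E (c : seq (E -> R)) (D : E -> dec) k
    (xi : E -> 'cV[R]_Nxi) (tau : E -> R) :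
  decision_coords_in c D -> (forall i, List.In (fun z => xi z i 0) c) ->
  List.In tau c -> definable c (fun z => payoff P (D z) k (xi z) <= tau z).
Proof.
move=> cD cxi ctau.
apply: (definable_ext (S := fun z => forall u : 'cV[R]_Ng,
  (forall s, (forall t, dot (vecg P s t) (xi z) <= u s 0) /\
             exists t, u s 0 = dot (vecg P s t) (xi z)) ->
  payoff_at (D z) k (xi z) u <= tau z)).
  move=> z; split=> [le_tau|le_tau u /gfun_eq -> //].
  by apply: le_tau; exact/gfun_eq.
pose ec := extend Ng c.
have cxi' : polynomial_mx ec (fun z => xi z.1).
  by apply: polynomial_mx_coord => i; exact: (extend_coord _ (cxi i)).
have cu : polynomial_mx ec snd by apply: polynomial_mx_coord => i; exact: extend_coord_new.
have cdot s t : polynomial_fun ec (fun z => dot (vecg P s t) (xi z.1)).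
  exact: polynomial_dot (polynomial_mx_const _ _) cxi'.
apply: (definable_forall_vec (S := fun z => (forall s,
  (forall t, dot (vecg P s t) (xi z.1) <= z.2 s 0) /\
  exists t, z.2 s 0 = dot (vecg P s t) (xi z.1)) ->
  payoff_at (D z.1) k (xi z.1) z.2 <= tau z.1)).
apply: definable_imp.
  apply: definable_forall_fin => s; apply: definable_and.
    by apply: definable_forall_fin => t; exact: definable_le.
  by apply: definable_exists_fin => t; exact: definable_eq.
apply: definable_le; last exact/polynomial_coord/extend_coord.
by apply: (polynomial_payoff (D := fun z => D z.1)) => //;
  exact: decision_coords_extend.
Qed.

(** The extrema over [xibar], [k] and [xi] become three alternating quantifiers; robust feasibility
    and the payoff bound share the innermost one. *)
Definition epigraph (d : dec) (tau : R) : Prop :=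
  forall xibar, Xi P xibar -> exists k : 'I_K, forall xi,
    XiW P (dw d) xibar xi ->
    vle (mapT P xi *m dx d + mapV P xi *m dw d + mapW P xi *m dy d k)
        (matH P *m xi) /\
    payoff P d k xi <= tau.

Lemma definable_epigraph E (c : seq (E -> R)) (D : E -> dec) (tau : E -> R) :
  decision_coords_in c D -> List.In tau c ->
  definable c (fun z => epigraph (D z) (tau z)).
Proof.
move=> cD ctau.
(* [c1] adds the coordinates of [xibar], and [c2] those of [xi]. *)
pose c1 := extend Nxi c; pose c2 := extend Nxi c1.
have cD1 : decision_coords_in c1 (fun z => D z.1) :=
  decision_coords_extend _ cD.
have cD2 : decision_coords_in c2 (fun z => D z.1.1) :=
  decision_coords_extend _ cD1.
have cbar1 : polynomial_mx c1 snd.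
  by apply: polynomial_mx_coord => i; exact: extend_coord_new.
have cbar2 : polynomial_mx c2 (fun z => z.1.2).
  apply: polynomial_mx_coord => i.
  exact: (extend_coord (p := fun z : E * 'cV[R]_Nxi => z.2 i 0) _ (extend_coord_new _ i)).
have cxi i : List.In (fun z : E * 'cV[R]_Nxi * 'cV[R]_Nxi => z.2 i 0) c2.
  exact: extend_coord_new.
apply: (definable_forall_vec (S := fun z => Xi P z.2 ->
  exists k : 'I_K, forall xi, XiW P (dw (D z.1)) z.2 xi ->
  vle (mapT P xi *m dx (D z.1) + mapV P xi *m dw (D z.1)
       + mapW P xi *m dy (D z.1) k) (matH P *m xi) /\
  payoff P (D z.1) k xi <= tau z.1)).
apply: definable_imp; first exact: definable_Xi.
apply: definable_exists_fin => k.
apply: (definable_forall_vec (S := fun z => XiW P (dw (D z.1.1)) z.1.2 z.2 ->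
  vle (mapT P z.2 *m dx (D z.1.1) + mapV P z.2 *m dw (D z.1.1)
       + mapW P z.2 *m dy (D z.1.1) k) (matH P *m z.2) /\
  payoff P (D z.1.1) k z.2 <= tau z.1.1)).
apply: definable_imp.
  by apply: (definable_XiW cD2) => //; exact: polynomial_mx_coord.
apply: definable_and.
  by apply: (definable_constraints cD2); exact: polynomial_mx_coord.
apply: (definable_payoff_le k cD2 cxi).
exact: (extend_coord (p := fun z : E * 'cV[R]_Nxi => tau z.1)
  _ (extend_coord _ ctau)).
Qed.

End Epigraph.

(** * Reformulations from the epigraph *)

(** An infimum over a nonempty finite set is attained; over the empty set it is [+oo], which no real
    [t] bounds. *)
Lemma ereal_inf_fin_le (R : realType) (I : finType) (A : set I)
    (f : I -> \bar R) (t : R) :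
  (ereal_inf [set f i | i in A] <= t%:E)%E <-> exists2 i, A i & (f i <= t%:E)%E.
Proof.
split=> [inf_le|[i Ai fi]]; last by apply: ge_ereal_inf; exists (f i) => //; exists i.
have [[i0 Ai0]|/forallNP A0] := pselect (exists i, A i); last first.
  have A_eq0 : A = set0 by rewrite -subset0 => i; exact: A0.
  by move: inf_le; rewrite A_eq0 image_set0 ereal_inf0 leye_eq.
have [|i /asboolP Ai imin] := @arg_minP _ _ _ i0 (fun i => `[<A i>]) f.
  exact/asboolP.
exists i => //; apply: le_trans inf_le; apply: le_ereal_inf_tmp => _ [j Aj <-].
exact/imin/asboolP.
Qed.

(** * The cost function and its epigraph *)

Section CostEpigraph.
Variables (R : realType) (K Nx Ny Nxi L nR Ng nT : nat).
Variable P : data R K Nx Ny Nxi L nR Ng nT.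
Implicit Types d : decision R K Nx Ny Nxi Ng.

(** A supremum is at most [t] exactly when all its members are; the infimum over policies is handled
    by finiteness of ['I_K]. *)
Lemma kadapt_cost_le d t : (kadapt_cost P d <= t%:E)%E <-> epigraph P d t.
Proof.
split=> [/ereal_supP cost_le xibar Xibar|epi].
  have /ereal_inf_fin_le[k kfeas /ereal_supP kle] :
    (inner_value P d xibar <= t%:E)%E by apply: cost_le; exists xibar.
  exists k => xi Xixi; split; first exact: kfeas.
  by rewrite -lee_fin; apply: kle; exists xi.
apply/ereal_supP => _ [xibar Xibar <-]; apply/ereal_inf_fin_le.
have [k kP] := epi _ Xibar; exists k => [xi /kP[]//|].
by apply/ereal_supP => _ [xi /kP[_ ?] <-]; rewrite lee_fin.
Qed.

(** Ensures that a cost other than [+oo] is real, hence a possible objective value of a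
    reformulation. *)
Lemma kadapt_cost_gtNy d : Xi P !=set0 -> (-oo < kadapt_cost P d)%E.
Proof.
move=> [xi Xixi]; rewrite ltNye; apply/eqP => cost_Ny.
(* [t] lies strictly below the payoff of every policy at [xi]. *)
pose t := - (\sum_(k < K) `|payoff P d k xi|) - 1.
have /kadapt_cost_le : (kadapt_cost P d <= t%:E)%E by rewrite cost_Ny leNye.
(* The point [xi] serves both as [xibar] and as a member of its own [XiW]. *)
move=> /(_ xi Xixi)[k /(_ xi)[]// _].
apply/negP; rewrite -ltNge /t.
have : `|payoff P d k xi| <= \sum_(k < K) `|payoff P d k xi|.
  by rewrite (bigD1 k) //= lerDl sumr_ge0.
by have := ler_norm (- payoff P d k xi); rewrite normrN; lra.
Qed.

(** By the two hypotheses, the completions of an admissible [d] attain exactly the real values at or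
    above its cost; when the cost is not [+oo], the least of them is the cost itself. *)
Lemma equivalent_reformulation_of_epigraph
    (F : reformulation R K Nx Ny Nxi Ng) :
  Xi P !=set0 ->
  (forall d a, rf_dom P (F := F) (d, a) ->
     kadapt_dom P d /\ (kadapt_cost P d <= rf_cost (F := F) (d, a))%E) ->
  (forall d t, kadapt_dom P d -> (kadapt_cost P d <= t%:E)%E ->
     exists2 a, rf_dom P (F := F) (d, a) & rf_cost (F := F) (d, a) = t%:E) ->
  equivalent_reformulation P F.
Proof.
move=> Xi0 rf_sound rf_complete.
have rf_attain d : kadapt_dom P d -> (kadapt_cost P d < +oo)%E ->
    exists2 a, rf_dom P (F := F) (d, a) & rf_cost (F := F) (d, a) = kadapt_cost P d.
  move=> dP cost_lty; rewrite -[kadapt_cost P d]fineK; last first.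
    by rewrite fin_real // kadapt_cost_gtNy.
  by apply: rf_complete => //; rewrite fineK // fin_real // kadapt_cost_gtNy.
split.
  apply/eqP; rewrite eq_le; apply/andP; split.
    apply: le_ereal_inf_tmp => _ [[d a] /rf_sound[dP cost_le] <-].
    by apply: ge_ereal_inf; exists (kadapt_cost P d) => //; exists d.
  apply: le_ereal_inf_tmp => _ [d dP <-].
  have [->|cost_lty] := eqVneq (kadapt_cost P d) +oo%E; first exact: leey.
  have [|a aP costE] := rf_attain d dP; first by rewrite ltey.
  by apply: ge_ereal_inf; exists (rf_cost (F := F) (d, a)); [exists (d, a)|rewrite costE].
move=> d; split=> [[dP cost_lty dmin]|[a [aP _ amin]]].
  have [a aP costE] := rf_attain d dP cost_lty; exists a; split=> //.
    by rewrite costE.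
  move=> [d' a'] /rf_sound[d'P cost_le]; rewrite costE.
  exact: le_trans (dmin _ d'P) cost_le.
have [dP cost_le] := rf_sound _ _ aP; split=> //.
  exact: le_lt_trans cost_le (ltey _).
move=> d' d'P; have [->|cost_lty] := eqVneq (kadapt_cost P d') +oo%E; first exact: leey.
have [|a' a'P <-] := rf_attain d' d'P; first by rewrite ltey.
exact: le_trans cost_le (amin _ a'P).
Qed.

End CostEpigraph.

(** * The reformulation built from a circuit for the epigraph *)

Theorem theorem3 (R : realType) (K Nx Ny Nxi L nR Ng nT : nat)
    (P : data R K Nx Ny Nxi L nR Ng nT)
    (K_ge1 : (1 <= K)%N)
    (T_ge1 : (1 <= nT)%N)
    (W_binary : setW P `<=` @binary R Nxi)
    (Xi_nonempty : Xi P !=set0)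
    (Xi_bounded : bounded_set (Xi P))
    (slater : moment_condition P) :
  exists F : reformulation R K Nx Ny Nxi Ng, equivalent_reformulation P F.
Proof.
(* The circuit inputs: the decision coordinates and, at [inr tt], the level [tau]. *)
pose I : finType := (decision_index K Nx Ny Nxi Ng + unit)%type.
pose coord (i : I) (z : decision R K Nx Ny Nxi Ng * R) : R :=
  join (decision_coord z.1) (fun=> z.2) i.
pose c := [seq coord i | i <- enum I].
have in_c i : List.In (coord i) c.
  apply: List.in_map; have := mem_enum I i.
  by elim: (enum I) => //= j s IH; rewrite inE => /predU1P[->|/IH]; [left|right].
have [f [qf rf fE]] : exists f, [/\ ord.qf_form f, ord.rformula f
    & forall z, ord.qf_eval (env c z) f <-> epigraph P z.1 z.2].
  apply/definable_qf/definable_epigraph => //; last exact: (in_c (inr tt)).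
  by move=> b; exact: (in_c (inl b)).
have [C Cf] := computable_qf_formula I qf rf.
(* Real auxiliary variables: [ord0] carries [tau], and the others carry the circuit. There are no
   binary ones. *)
pose m := #|aux C|.+1.
pose h (k : I + aux C) : dvar K Nx Ny Nxi Ng m 0 :=
  match k with
  | inl (inl b) => inl (inl b)
  | inl (inr _) => inl (inr ord0)
  | inr a => inl (inr (lift ord0 (enum_rank a)))
  end.
have h_inj : injective h.
  move=> [[b|[]]|a] [[b'|[]]|a'] //=.
  - by move=> [->].
  - by move=> h_eq; rewrite (enum_rank_inj (lift_inj (inr_inj (inl_inj h_eq)))).
have [obj objE] := bilinear_var R (inl (inr ord0) : dvar K Nx Ny Nxi Ng m 0).
have [e_gate gateE] := choice (fun l => bilinear_reindex h_inj (@gate_bilinear _ _ C l)).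
(* Requiring output 1 forces the pair of decision and [tau] into the epigraph. *)
have [e_out outE] : bilinear_fun
    (fun w : dvar K Nx Ny Nxi Ng m 0 -> R => w (h (inr (out C))) - 1).
  by bilinear.
pose F := Reformulation obj [::] (e_out :: [seq e_gate l | l <- enum (label C)]).
have assignmentE d (r : 'cV[R]_m) v :
    assignment (F := F) (d, (r, v)) \o h =
    join (fun i => coord i (d, r ord0 0))
         (fun a => r (lift ord0 (enum_rank a)) 0).
  by apply/funext => -[[[[[s|j]|j]|[k j]]|[]]|a].
have rf_domE d r v : rf_dom P (F := F) (d, (r, v)) <->
    [/\ kadapt_dom P d, binary v & solution (fun i => coord i (d, r ord0 0))
          (fun a => r (lift ord0 (enum_rank a)) 0) /\
        r (lift ord0 (enum_rank (out C))) 0 = 1].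
  pose w := assignment (F := F) (d, (r, v)).
  have gatesE : all (fun e => bl_eval e w == 0) (rf_eqs F) =
      (bl_eval e_out w == 0) && all (fun l => gate l (w \o h) == 0) (enum (label C)).
    by rewrite /= all_map; congr (_ && _); apply: eq_all => l; rewrite /= gateE.
  split=> [[dP vb _]|[dP vb [rs ro]]].
    rewrite [all _ _]gatesE outE /w assignmentE => /andP[/eqP ro /allP rs].
    by split=> //; split=> [l|]; [apply/eqP/rs; rewrite mem_enum|exact: subr0_eq ro].
  split=> //; rewrite [all _ _]gatesE outE /w assignmentE /= ro subrr eqxx /=.
  by apply/allP => l _; apply/eqP; exact: rs.
have envE z : [seq coord i z | i <- enum I] = env c z.
  by rewrite /env /c -[RHS]map_comp.
exists F; apply: equivalent_reformulation_of_epigraph => //.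
  (* The gates determine the output as the truth value of the formula; since it is 1, the formula
     holds. *)
  move=> d [r v] /rf_domE[dP _ [rs ro]]; split=> //.
  rewrite /rf_cost objE /=; apply/kadapt_cost_le/(fE (_, _)).
  have := (Cf _).2 _ rs; rewrite ro envE; case: ord.qf_eval => //=.
  by move/eqP; rewrite oner_eq0.
move=> d t dP /kadapt_cost_le epi.
have [[s sP] s_out] := Cf (fun i => coord i (d, t)).
(* Stores [t] at index 0 and the circuit solution [s] at the shifted indices. *)
pose r : 'cV[R]_m := \col_i if unlift ord0 i is Some a then s (enum_val a) else t.
have r0 : r ord0 0 = t by rewrite mxE unlift_none.
have rS a : r (lift ord0 (enum_rank a)) 0 = s a by rewrite mxE liftK enum_rankK.
exists (r, 0); last by rewrite /rf_cost objE /= r0.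
have rSE : (fun a => r (lift ord0 (enum_rank a)) 0) = s by apply/funext.
apply/rf_domE; split=> //; first by case.
rewrite r0 rS rSE; split=> //; rewrite s_out // envE.
by have /(fE (d, t)) -> := epi.
Qed.
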